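(* Let $M$ be a matroid of rank $r$ on $n$ elements and let $C$ be a circuit of $M$. If $|C|=r+1$, then $\beta_C=\binom{n}{r+1}^{-1}$.
   Context: Matroid bingo: let $M$ be a matroid on a finite set $E$ with $|E|=n$ and circuit set $\mathcal{C}$. The elements of $E$ are called out one at a time in a uniformly random order $\sigma(1),\sigma(2),\dots,\sigma(n)$ (a uniformly random permutation of $E$). A circuit $C$ wins in round $t$ if $C\subseteq\{\sigma(1),\dots,\sigma(t)\}$ and no circuit of $M$ is contained in $\{\sigma(1),\dots,\sigma(t-1)\}$; thus the winner is the first circuit to be completed (the circuit axioms guarantee that there is no tie). $\beta_C$ denotes the probability that $C$ wins (in some round). *)

(* Defs.v *)
From mathcomp Require Import all_boot all_order all_algebra.
Set Implicit Arguments.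
Unset Strict Implicit.
Unset Printing Implicit Defensive.
Import GRing.Theory.

(* The ground set is the whole finite type E; the empty type is allowed. *)
Record matroid (E : finType) := Matroid {
  indep : {set {set E}};
  indep0 : set0 \in indep;
  indepS : forall I J : {set E}, J \in indep -> I \subset J -> I \in indep;
  indep_augment : forall I J : {set E}, I \in indep -> J \in indep ->
    #|I| < #|J| -> exists2 x, x \in J :\: I & x |: I \in indep
}.

Definition circuits (E : finType) (M : matroid E) : {set {set E}} :=
  [set C | minset (fun A => A \notin indep M) C].

Definition rank (E : finType) (M : matroid E) : nat :=
  \max_(I in indep M) #|I|.

(* Calling orders: as #|'I_#|E| | = #|E|, the injections are the bijections.
   Indices start at 0, so s i is the element called in round i + 1. *)
Definition orders (E : finType) : {set {ffun 'I_#|E| -> E}} :=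
  [set s : {ffun 'I_#|E| -> E} | injectiveb s].

(* The elements called in rounds 1, ..., t. *)
Definition called (E : finType) (s : {ffun 'I_#|E| -> E}) (t : nat) : {set E} :=
  [set s i | i : 'I_#|E| & i < t].

Definition wins_in_round (E : finType) (M : matroid E)
    (s : {ffun 'I_#|E| -> E}) (t : nat) (C : {set E}) : bool :=
  [&& C \in circuits M, C \subset called s t &
  [forall D in circuits M, ~~ (D \subset called s t.-1)]].

Definition wins (E : finType) (M : matroid E)
    (s : {ffun 'I_#|E| -> E}) (C : {set E}) : bool :=
  [exists t : 'I_#|E|, wins_in_round M s t.+1 C].

Definition win_prob (E : finType) (M : matroid E) (C : {set E}) : rat :=
  (#|[set s in orders E | wins M s C]|%:R / #|orders E|%:R)%R.

(* Main.v *)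
Require Import Defs.
From mathcomp Require Import all_boot all_order all_algebra.

(* A circuit of size r + 1 can only win in round r + 1, since the elements
   called before its win form an independent set; hence C wins exactly when it
   is the set of the first r + 1 elements called.  By symmetry, that set is
   uniformly distributed over the sets of r + 1 elements. *)

(** List [A] and then its complement, and likewise for [B]; [p] sends the entry at each position of
    the first list to the entry at the same position of the second. *)
Lemma exists_inj_imset (T : finType) (A B : {set T}) :
  #|A| = #|B| -> exists2 p : T -> T, injective p & p @: A = B.
Proof.
move=> eqAB.
pose l (X : {set T}) := enum X ++ enum (~: X).
have lin X x : x \in l X by rewrite mem_cat !mem_enum inE orbN.
have luniq X : uniq (l X).
  rewrite cat_uniq !enum_uniq andbT /=; apply/hasPn => x.
  by rewrite !mem_enum inE.
have lsz X : size (l X) = #|T| by rewrite size_cat -!cardE cardsC.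
have pinj : injective (fun x => nth x (l B) (index x (l A))).
  move=> x y; have ltx z : index z (l A) < size (l B).
    by rewrite lsz -(lsz A) index_mem.
  (* The two [nth] have defaults [x] and [y]; as both indices are in range, the defaults can be made
     equal, as [nth_uniq] requires. *)
  rewrite (set_nth_default x y) // => /eqP.
  rewrite nth_uniq // => /eqP eqi.
  by rewrite -(nth_index x (lin A x)) eqi nth_index.
exists (fun x => nth x (l B) (index x (l A))) => //.
apply/eqP; rewrite eqEcard card_imset // eqAB leqnn andbT.
apply/subsetP => _ /imsetP[x xA ->].
(* Elements of [A] occupy the first [#|A|] positions, which in [l B] hold the elements of [B]. *)
have ltx : index x (enum A) < size (enum B).
  by rewrite -cardE -eqAB cardE index_mem mem_enum.
by rewrite index_cat mem_enum xA nth_cat ltx -mem_enum mem_nth.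
Qed.

Section Orders.

Set Implicit Arguments.
Unset Strict Implicit.

Variable E : finType.
Implicit Types (s : {ffun 'I_#|E| -> E}) (A B : {set E}).

Lemma mem_orders s : s \in orders E -> injective s.
Proof. by rewrite inE => /injectiveP. Qed.

Lemma card_orders : #|orders E| = #|E|`!.
Proof. by rewrite /orders card_inj_ffuns card_ord ffactnn. Qed.

Lemma card_called s k : s \in orders E -> k <= #|E| -> #|called s k| = k.
Proof.
move=> /mem_orders s_inj lek; rewrite /called card_imset //.
transitivity #|[set widen_ord lek i | i : 'I_k]|; last first.
  by rewrite card_imset ?card_ord // => i j /(congr1 val) /= /val_inj.
apply: eq_card => i; rewrite inE; apply/idP/imsetP => [ltik | [j _ ->]] //=.
by exists (Ordinal ltik) => //; apply: val_inj.
Qed.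

Lemma calledS s k l : k <= l -> called s k \subset called s l.
Proof.
move=> lekl; apply: imsetS; apply/subsetP => i.
by rewrite !inE => /leq_trans; apply.
Qed.

(** Composition with a permutation of [E] that carries [A] onto [B] injects the first set of orders
    into the second. Exchanging [A] and [B] then gives equality. *)
Lemma leq_card_called_eq A B k : #|A| = #|B| ->
  #|[set s in orders E | called s k == A]| <=
  #|[set s in orders E | called s k == B]|.
Proof.
move=> /exists_inj_imset[p p_inj <-].
pose f s : {ffun 'I_#|E| -> E} := [ffun i => p (s i)].
have f_inj : injective f.
  by move=> s t /ffunP eqf; apply/ffunP=> i; have := eqf i; rewrite !ffunE => /p_inj.
rewrite -(card_imset _ f_inj); apply/subset_leq_card/subsetP => _ /imsetP[s + ->].
rewrite !inE => /andP[/injectiveP s_inj /eqP <-]; apply/andP; split.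
  by apply/injectiveP => i j; rewrite !ffunE => /p_inj /s_inj.
rewrite /called -imset_comp; apply/eqP/eq_imset => i /=.
by rewrite ffunE.
Qed.

(** Sort all orders by the set of their first [#|A|] elements: there is one class for each set of
    that size, and all classes are equally large. *)
Lemma card_called_eq A :
  (#|[set s in orders E | called s #|A| == A]| * 'C(#|E|, #|A|))%N = #|E|`!.
Proof.
set k := #|A|; rewrite -card_orders mulnC -card_draws -sum_nat_const.
rewrite -[RHS]sum1_card (partition_big (fun s => called s k)
  (mem [set B : {set E} | #|B| == k])) => [|s sO]; last first.
  by rewrite /= inE card_called // max_card.
apply: eq_bigr => B; rewrite inE => /eqP cardB.
rewrite sum1dep_card; apply/eqP.
by rewrite eqn_leq !leq_card_called_eq.
Qed.

End Orders.

Section Circuits.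

Set Implicit Arguments.
Unset Strict Implicit.

Variables (E : finType) (M : matroid E).
Implicit Types A C D : {set E}.

Lemma circuit_min C D : C \in circuits M -> D \in circuits M ->
  D \subset C -> D = C.
Proof.
rewrite !inE => /minsetP[_ minC] /minsetP[dD _]; exact: minC.
Qed.

Lemma dependent_circuit A : A \notin indep M ->
  exists2 D, D \in circuits M & D \subset A.
Proof.
case/(minset_exists (P := fun B => B \notin indep M)) => D minD sDA.
by exists D; rewrite ?inE.
Qed.

Lemma indep_rank A : A \in indep M -> #|A| <= rank M.
Proof. exact: (@leq_bigmax_cond _ (mem (indep M)) (fun I : {set E} => #|I|)). Qed.

Lemma wins_called (s : {ffun 'I_#|E| -> E}) C : s \in orders E ->
  C \in circuits M -> #|C| = (rank M).+1 ->
  wins M s C = (called s #|C| == C).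
Proof.
move=> sO cC cardC; apply/existsP/eqP => [[t /and3P[_ sCt /forall_inP noD]] | eqC].
  (* No circuit is complete before the winning round [t.+1], so the [t] elements called by then are
     independent and [t <= rank M]. *)
  have indt : called s t \in indep M.
    apply: contraT => /dependent_circuit[D cD sDt].
    by rewrite (negPf (noD D cD)) in sDt.
  have := indep_rank indt; rewrite card_called ?(ltnW (ltn_ord t)) // => ler.
  have tC : t.+1 <= #|C| by rewrite cardC.
  apply/esym/eqP; rewrite eqEcard card_called ?max_card // leqnn andbT.
  exact: subset_trans sCt (calledS s _).
have ltr : rank M < #|E| by rewrite -cardC max_card.
(* The index [rank M] stands for round [(rank M).+1], which is [#|C|]. *)
exists (Ordinal ltr); rewrite /wins_in_round cC /= -cardC eqC subxx /=.
apply/forall_inP => D cD; apply/negP => sDr.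
(* A circuit completed earlier would lie in [C], hence equal [C], which has more than [rank M]
   elements. *)
have sDC : D \subset C.
  by apply: subset_trans sDr _; rewrite -[in X in _ \subset X]eqC cardC calledS.
have := subset_leq_card sDr.
by rewrite (circuit_min cC cD sDC) card_called ?(ltnW ltr) // cardC ltnn.
Qed.

End Circuits.

Theorem corollary6 (E : finType) (M : matroid E) (n r : nat) (C : {set E})
    (card_E : #|E| = n) (rank_M : rank M = r)
    (circuit_C : C \in circuits M) (card_C : #|C| = r.+1) :
  win_prob M C = (('C(n, r.+1))%:R^-1)%R.
Proof.
have cardC : #|C| = (rank M).+1 by rewrite rank_M.
rewrite /win_prob card_orders -(card_called_eq C) -card_E -card_C.
have -> : [set s in orders E | wins M s C] =
          [set s in orders E | called s #|C| == C].
  apply/setP => s; rewrite 2!inE; case sO: (s \in orders E) => //=.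
  by rewrite (wins_called).
(* The number of winning orders divides [#|E|]!, so it is nonzero and cancels from the fraction. *)
have := fact_gt0 #|E|; rewrite -(card_called_eq C) muln_gt0 => /andP[N_gt0 _].
rewrite GRing.natrM GRing.invfM GRing.mulrA GRing.divff ?GRing.mul1r //.
by rewrite Num.Theory.pnatr_eq0 -lt0n.
Qed.
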